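(* There is a universal constant $C>0$ such that the following holds. For every tabular and episodic MDP satisfying the Reset Cliff assumption and every $\varepsilon\in(0,H]$, if the number $m\ge1$ of expert trajectories satisfies $m\ge C|\mathcal S|/\varepsilon^2$, then any VAIL solution $\pi^{\mathrm{AIL}}$, i.e. any minimizer over $\pi\in\Pi$ of $\sum_{h=1}^H\sum_{(s,a)}|P^\pi_h(s,a)-\widehat P^{\pi^{E}}_h(s,a)|$, satisfies $V^{\pi^{E}}-\mathbb E[V^{\pi^{\mathrm{AIL}}}]\le\varepsilon$, where the expectation is over the random expert dataset. (That is, VAIL requires at most $O(|\mathcal S|/\varepsilon^2)$ expert trajectories in expectation, independently of the horizon.)
   Context: A tabular episodic MDP is a tuple $(\mathcal S,\mathcal A,P,r,H,\rho)$ with finite $\mathcal S,\mathcal A$, horizon $H$, time-dependent transitions $P_h(s'|s,a)$, rewards $r_h\in[0,1]$, and initial state distribution $\rho$. $\Pi$ is the set of all non-stationary stochastic policies $\pi=(\pi_1,\dots,\pi_H)$, $\pi_h:\mathcal S\to\Delta(\mathcal A)$. $V^\pi$ is the expected total reward over $H$ steps; $P^\pi_h(s,a)$ is the probability of $(s_h,a_h)=(s,a)$ under $\pi$. The expert $\pi^{E}$ is deterministic; $\mathcal D$ consists of $m$ i.i.d. length-$H$ trajectories of $\pi^{E}$; $\widehat P^{\pi^{E}}_h(s,a)$ is the fraction of trajectories in $\mathcal D$ with $(s_h,a_h)=(s,a)$. Reset Cliff assumption: $\mathcal S=\mathcal S^{G}\sqcup\mathcal S^{B}$ (good and bad states). On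 every good state the action $a^1$ is the expert action with reward $1$ and all other actions are non-expert with reward $0$; on bad states all actions have reward $0$. For all $h$ and $s,s'\in\mathcal S^{G}$: $P_h(s'|s,a^1)>0$ and $\sum_{s''\in\mathcal S^{G}}P_h(s''|s,a^1)=1$; for $a\ne a^1$ and $s\in\mathcal S^G$, $\sum_{s''\in\mathcal S^{B}}P_h(s''|s,a)=1$. From bad states, every action leads to bad states. The initial distribution is supported on good states: $\rho(s)=0$ for $s\in\mathcal S^{B}$. *)

(* Defs.v *)
(* MathComp world; the reals are an arbitrary R : realType. *)
From HB Require Import structures.
From mathcomp Require Import all_boot all_order all_algebra.
From mathcomp Require Import reals.

Set Implicit Arguments.
Unset Strict Implicit.
Unset Printing Implicit Defensive.

Import Order.TTheory GRing.Theory Num.Theory.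
Local Open Scope ring_scope.

(* The simplex Delta(T). *)
Record pmf (R : realType) (T : finType) := Pmf {
  pmf_fun :> T -> R;
  pmf_ge0 : forall x, 0 <= pmf_fun x;
  pmf_sum1 : \sum_x pmf_fun x = 1
}.

Lemma dirac_ge0 (R : realType) (T : finType) (x y : T) :
  0 <= (y == x)%:R :> R.
Proof. exact: ler0n. Qed.

Lemma dirac_sum1 (R : realType) (T : finType) (x : T) :
  \sum_y (y == x)%:R = 1 :> R.
Proof. by rewrite (bigD1 x) //= eqxx big1 ?addr0 // => y /negbTE->. Qed.

Definition dirac (R : realType) (T : finType) (x : T) : pmf R T :=
  Pmf (dirac_ge0 R x) (dirac_sum1 R x).

(* Steps 1, ..., H are represented by 'I_H, i.e. shifted to 0, ..., H - 1.
   The last transition kernel never influences a length-H trajectory. *)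
Record mdp (R : realType) (S A : finType) (H : nat) := Mdp {
  trans : 'I_H -> S -> A -> pmf R S;
  reward : 'I_H -> S -> A -> R;
  init : pmf R S;
  reward_bounds : forall h s a, 0 <= reward h s a <= 1
}.

Definition policy (R : realType) (S A : finType) (H : nat) :=
  'I_H -> S -> pmf R A.

Definition det_policy (R : realType) (S A : finType) (H : nat)
    (f : 'I_H -> S -> A) : policy R S A H :=
  fun h s => dirac R (f h s).

Definition trajectory (S A : finType) (H : nat) := {ffun 'I_H -> S * A}.

Section Mdp.
Context {R : realType} {S A : finType} {H : nat}.
Variable M : mdp R S A H.
Implicit Types (pi : policy R S A H) (tau : trajectory S A H).

(* Conditions [h = 0 :> nat] and [h' = h.+1 :> nat] select the first step and
   the pairs of consecutive steps, with no special case for H = 0. *)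
Definition traj_prob pi tau : R :=
  (\prod_(h < H | h == 0%N :> nat) init M (tau h).1)
  * (\prod_(h < H) pi h (tau h).1 (tau h).2)
  * (\prod_(h < H) \prod_(h' < H | h' == h.+1 :> nat)
       trans M h (tau h).1 (tau h).2 (tau h').1).

Definition value pi : R :=
  \sum_(tau : trajectory S A H) traj_prob pi tau
    * \sum_(h < H) reward M h (tau h).1 (tau h).2.

Definition occupancy pi (h : 'I_H) (s : S) (a : A) : R :=
  \sum_(tau : trajectory S A H | tau h == (s, a)) traj_prob pi tau.

Definition dataset (m : nat) := {ffun 'I_m -> trajectory S A H}.

Definition dataset_prob (m : nat) pi (D : dataset m) : R :=
  \prod_(i < m) traj_prob pi (D i).

Definition dataset_expectation (m : nat) pi (f : dataset m -> R) : R :=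
  \sum_(D : dataset m) dataset_prob pi D * f D.

Definition empirical (m : nat) (D : dataset m)
    (h : 'I_H) (s : S) (a : A) : R :=
  #|[set i : 'I_m | D i h == (s, a)]|%:R / m%:R.

Definition vail_loss (m : nat) (D : dataset m) pi : R :=
  \sum_(h < H) \sum_(s : S) \sum_(a : A)
    `|occupancy pi h s a - empirical D h s a|.

Definition vail_solution (m : nat) (D : dataset m) pi : Prop :=
  forall pi' : policy R S A H, vail_loss D pi <= vail_loss D pi'.

End Mdp.

Arguments dataset : clear implicits.

(* [good] is the set of good states, its complement the set of bad states;
   [expert] is the deterministic expert, unconstrained on bad states. *)
Record reset_cliff (R : realType) (S A : finType) (H : nat)
    (M : mdp R S A H) (expert : 'I_H -> S -> A)
    (good : {set S}) (a1 : A) : Prop := ResetCliff {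
  rc_expert : forall h s, s \in good -> expert h s = a1;
  rc_reward_a1 : forall h s, s \in good -> reward M h s a1 = 1;
  rc_reward_other : forall h s a,
    s \in good -> a != a1 -> reward M h s a = 0;
  rc_reward_bad : forall h s a, s \notin good -> reward M h s a = 0;
  rc_trans_pos : forall h s s',
    s \in good -> s' \in good -> 0 < trans M h s a1 s';
  rc_trans_good : forall h s,
    s \in good -> \sum_(s'' in good) trans M h s a1 s'' = 1;
  rc_trans_cliff : forall h s a,
    s \in good -> a != a1 -> \sum_(s'' in ~: good) trans M h s a s'' = 1;
  rc_trans_bad : forall h s a,
    s \notin good -> \sum_(s'' in ~: good) trans M h s a s'' = 1;
  rc_init : forall s, s \notin good -> init M s = 0
}.

(* Main.v *)
(** Write e for the empirical distribution and P^pi for the occupancy measure.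
    Both have total mass 1, and e is carried by the pairs (good state, a1) on
    datasets of positive probability, so the loss is
    2 sum_h sum_(s in good) (e_h(s,a1) - P^pi_h(s,a1))^+.
    Since P^pi_h(s,a1) <= P^E_h(s,a1) on good states, the expert minimizes every
    term, and any minimizer agrees with it term by term.  At each step h + 1 some
    good state has e >= P^E, hence P^pi = P^E there; as every good state reaches
    it with positive probability, P^pi_h(.,a1) = P^E_h(.,a1).  Only the last step
    contributes to the value gap, which is thus at most
    sum_(s in good) |P^E_H(s,a1) - e_H(s,a1)|; its expectation is bounded by the
    variance of e and AM-GM, and C = 1 works. *)
Require Import Defs.
From HB Require Import structures.
From mathcomp Require Import all_boot all_order all_algebra.
From mathcomp Require Import reals.
From mathcomp Require Import ring lra.

Set Implicit Arguments.
Unset Strict Implicit.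
Unset Printing Implicit Defensive.

Import Order.TTheory GRing.Theory Num.Theory.
Local Open Scope ring_scope.

(** * Path weights and marginals of finite Markov chains *)

Section MarkovChain.
Context {R : comNzRingType} {X : finType}.
Implicit Types (mu : X -> R) (K : nat -> X -> X -> R).

(** Kernels are indexed by [nat], so the same [K] serves paths of every length in inductions on
    [n]. *)
Definition path_weight mu K n (tau : {ffun 'I_n.+1 -> X}) : R :=
  mu (tau ord0) * \prod_(i < n) K i (tau (inord i)) (tau (inord i.+1)).

Fixpoint marginal mu K k : X -> R :=
  if k is k'.+1 then fun y => \sum_x marginal mu K k' x * K k' x y else mu.

Definition ffun_rcons n (tau : {ffun 'I_n.+1 -> X}) (y : X) :
    {ffun 'I_n.+2 -> X} :=
  [ffun i : 'I_n.+2 => if (i < n.+1)%N then tau (inord i) else y].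

Lemma sum_ffun_rcons n (G : {ffun 'I_n.+2 -> X} -> R) :
  \sum_tau G tau = \sum_(tau : {ffun 'I_n.+1 -> X}) \sum_y G (ffun_rcons tau y).
Proof.
rewrite pair_big /= (reindex (fun p => ffun_rcons p.1 p.2)) //=.
exists (fun tau : {ffun 'I_n.+2 -> X} =>
  ([ffun i : 'I_n.+1 => tau (inord i)], tau ord_max)) => [[tau y] _|tau _] /=.
- congr (_, _); last by rewrite ffunE /= ltnn.
  apply/ffunP => i; rewrite !ffunE inordK ?ltn_ord ?inord_val //.
  by rewrite ltnS ltnW.
- apply/ffunP => i; rewrite !ffunE; case: ltnP => hi.
    by rewrite inordK // inord_val.
  congr (tau _); apply/val_inj => /=; apply/eqP.
  by rewrite eqn_leq hi -ltnS ltn_ord.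
Qed.

Lemma ffun_rcons_inord n (tau : {ffun 'I_n.+1 -> X}) y i : (i <= n)%N ->
  ffun_rcons tau y (inord i) = tau (inord i).
Proof. by move=> hi; rewrite ffunE inordK ?ltnS ?hi // ltnW. Qed.

Lemma ffun_rcons_max n (tau : {ffun 'I_n.+1 -> X}) y :
  ffun_rcons tau y (inord n.+1) = y.
Proof. by rewrite ffunE inordK // ltnn. Qed.

Lemma path_weight_rcons mu K n (tau : {ffun 'I_n.+1 -> X}) y :
  path_weight mu K (ffun_rcons tau y)
  = path_weight mu K tau * K n (tau (inord n)) y.
Proof.
rewrite /path_weight big_ord_recr /= mulrA; congr (_ * _ * _).
- by rewrite ffunE; congr (mu (tau _)); apply/val_inj; rewrite /= inordK.
- apply: eq_bigr => i _.
  by rewrite !ffun_rcons_inord //; apply: ltnW.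
- by rewrite ffun_rcons_inord // ffun_rcons_max.
Qed.

(** Induction on the length: a last coordinate other than [k] sums out to 1; if [k] is last, one
    kernel step is absorbed into the test function. *)
Lemma sum_path_weight mu K (hK : forall i x, \sum_y K i x y = 1)
    n (k : 'I_n.+1) (F : X -> R) :
  \sum_(tau : {ffun 'I_n.+1 -> X}) path_weight mu K tau * F (tau k)
  = \sum_x marginal mu K k x * F x.
Proof.
elim: n => [|n IHn] in k F *.
  rewrite (ord1 k) /=.
  rewrite (reindex (fun x => [ffun=> x] : {ffun 'I_1 -> X})) /=; last first.
    exists (fun tau : {ffun 'I_1 -> X} => tau ord0) => [x _|tau _].
      by rewrite ffunE.
    by apply/ffunP => i; rewrite ffunE (ord1 i).
  by apply: eq_bigr => x _; rewrite /path_weight big_ord0 !ffunE mulr1.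
rewrite sum_ffun_rcons; have [hk|hk] := ltnP k n.+1.
  rewrite -[RHS](IHn (Ordinal hk) F); apply: eq_bigr => tau _.
  rewrite -[RHS]mulr1 -(hK n (tau (inord n))) mulr_sumr.
  apply: eq_bigr => y _; rewrite path_weight_rcons ffunE hk mulrAC.
  by congr (_ * F (tau _) * _); apply/val_inj; rewrite /= inordK.
have -> : k = inord n.+1.
  apply/val_inj; rewrite /= inordK //; apply/eqP.
  by rewrite eqn_leq hk -ltnS ltn_ord.
rewrite exchange_big inordK //=; apply: eq_bigr => y _.
(* Reading [n] as the value of [inord n] lets the induction hypothesis apply at the penultimate
   coordinate. *)
rewrite -[n in marginal _ _ n](@inordK n) // mulr_suml.
under eq_bigr => tau _ do rewrite path_weight_rcons ffun_rcons_max -mulrA.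
rewrite (IHn (inord n) (fun x => K n x y * F y)) inordK //.
by apply: eq_bigr => x _; rewrite mulrA.
Qed.

End MarkovChain.


(** Consecutive steps are two ordinals linked by an equation in [nat], as in [traj_prob], which
    avoids casts. *)
Lemma ord_step_ind n (P : 'I_n.+1 -> Prop) : P ord0 ->
  (forall h h' : 'I_n.+1, h' = h.+1 :> nat -> P h -> P h') -> forall h, P h.
Proof.
move=> P0 PS [k hk]; elim: k => [|k IHk] in hk *.
  by rewrite (_ : Ordinal hk = ord0) //; apply/val_inj.
exact: (PS (Ordinal (ltnW hk))).
Qed.

(** * Trajectories as a Markov chain on state-action pairs; occupancy measures *)

Section Occupancy.
Context {R : realType} {S A : finType} {n : nat}.
Variables (M : mdp R S A n.+1) (pi : policy R S A n.+1).
Implicit Types (h : 'I_n.+1) (s : S) (a : A).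

Definition init_step (x : S * A) : R := init M x.1 * pi ord0 x.1 x.2.

(** Paths only use [i < n]; beyond that [inord] falls back to step 0, which keeps the kernel
    stochastic for every [i], as [sum_path_weight] requires. *)
Definition next_step (i : nat) (x y : S * A) : R :=
  trans M (inord i) x.1 x.2 y.1 * pi (inord i.+1) y.1 y.2.

Lemma sum_mul_policy h (F : S -> R) :
  \sum_(y : S * A) F y.1 * pi h y.1 y.2 = \sum_s F s.
Proof.
rewrite -(pair_bigA _ (fun s a => F s * pi h s a)) /=.
by apply: eq_bigr => s _; rewrite -mulr_sumr pmf_sum1 mulr1.
Qed.

Lemma traj_probE tau : traj_prob M pi tau = path_weight init_step next_step tau.
Proof.
rewrite /traj_prob /path_weight /init_step (big_pred1 ord0) //.
rewrite -[RHS]mulrA -!mulrA; congr (_ * _).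
rewrite big_ord_recl -mulrA; congr (_ * _).
(* The last step has no successor, so its inner product is empty. *)
rewrite [X in _ * X]big_ord_recr /= [X in _ * (_ * X)]big1 ?mulr1; last first.
  by move=> h /eqP hh; have := ltn_ord h; rewrite hh ltnn.
rewrite -big_split /=; apply: eq_bigr => i _.
have hi : lift ord0 i = inord i.+1 :> 'I_n.+1.
  by apply/val_inj; rewrite /= inordK ?ltnS.
have hw : widen_ord (leqnSn n) i = inord i.
  by apply/val_inj; rewrite /= inordK // ltnW // ltnS.
rewrite (big_pred1 (lift ord0 i)) => [|h] /=; last by rewrite -val_eqE.
by rewrite mulrC /next_step hw hi.
Qed.

Lemma sum_next_step i x : \sum_y next_step i x y = 1.
Proof. by rewrite sum_mul_policy pmf_sum1. Qed.

Lemma sum_traj_prob_coord h (F : S * A -> R) :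
  \sum_tau traj_prob M pi tau * F (tau h)
  = \sum_x marginal init_step next_step h x * F x.
Proof.
under eq_bigr => tau _ do rewrite traj_probE.
exact: (sum_path_weight _ sum_next_step).
Qed.

Lemma sum_traj_prob : \sum_tau traj_prob M pi tau = 1.
Proof.
under eq_bigr => tau _ do rewrite -[traj_prob _ _ _]mulr1.
rewrite (sum_traj_prob_coord ord0 (fun=> 1)) /=.
under eq_bigr => x _ do rewrite mulr1.
by rewrite sum_mul_policy pmf_sum1.
Qed.

Lemma occupancyE h s a :
  occupancy M pi h s a = marginal init_step next_step h (s, a).
Proof.
rewrite /occupancy big_mkcond /=.
transitivity (\sum_tau traj_prob M pi tau * (tau h == (s, a))%:R).
  by apply: eq_bigr => tau _; case: eqP; rewrite ?mulr1 ?mulr0.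
rewrite (sum_traj_prob_coord h (fun x => (x == (s, a))%:R)).
rewrite (bigD1 (s, a)) //= eqxx mulr1 big1 ?addr0 // => x /negbTE ->.
by rewrite mulr0.
Qed.

Lemma sum_traj_prob_occupancy h (F : S * A -> R) :
  \sum_tau traj_prob M pi tau * F (tau h)
  = \sum_x occupancy M pi h x.1 x.2 * F x.
Proof.
by rewrite sum_traj_prob_coord; apply: eq_bigr => -[s a] _; rewrite occupancyE.
Qed.

Lemma sum_occupancy h : \sum_(x : S * A) occupancy M pi h x.1 x.2 = 1.
Proof.
rewrite -sum_traj_prob.
under [RHS]eq_bigr => tau _ do rewrite -[traj_prob _ _ _]mulr1.
rewrite (sum_traj_prob_occupancy h (fun=> 1)).
by apply: eq_bigr => x _; rewrite mulr1.
Qed.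

Lemma valueE : value M pi
  = \sum_h \sum_(x : S * A) occupancy M pi h x.1 x.2 * reward M h x.1 x.2.
Proof.
rewrite /value; under eq_bigr => tau _ do rewrite mulr_sumr.
rewrite exchange_big; apply: eq_bigr => h _.
exact: (sum_traj_prob_occupancy h (fun x => reward M h x.1 x.2)).
Qed.

Lemma occupancy_ord0 s a : occupancy M pi ord0 s a = init M s * pi ord0 s a.
Proof. by rewrite occupancyE. Qed.

Lemma occupancy_succ h h' s' a' : h' = h.+1 :> nat ->
  occupancy M pi h' s' a'
  = (\sum_(x : S * A) occupancy M pi h x.1 x.2 * trans M h x.1 x.2 s')
    * pi h' s' a'.
Proof.
move=> hh'; rewrite occupancyE hh' /= mulr_suml.
apply: eq_bigr => -[s a] _; rewrite occupancyE /next_step /= mulrA.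
by rewrite inord_val -hh' inord_val.
Qed.

Lemma traj_prob_ge0 tau : 0 <= traj_prob M pi tau.
Proof.
by rewrite !mulr_ge0 //; do ?[apply: prodr_ge0 => ? _]; apply: pmf_ge0.
Qed.

Lemma occupancy_ge0 h s a : 0 <= occupancy M pi h s a.
Proof. by apply: sumr_ge0 => tau _; apply: traj_prob_ge0. Qed.

(** Serves to turn a zero of the occupancy into a zero probability for every trajectory through that
    pair. *)
Lemma le_traj_prob_occupancy h tau :
  traj_prob M pi tau <= occupancy M pi h (tau h).1 (tau h).2.
Proof.
rewrite /occupancy (bigD1 tau) /=; last by rewrite -surjective_pairing.
by rewrite lerDl; apply: sumr_ge0 => tau' _; apply: traj_prob_ge0.
Qed.

End Occupancy.

Lemma pmf_le1 (R : realType) (T : finType) (p : pmf R T) x : p x <= 1.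
Proof.
by rewrite -(pmf_sum1 p) (bigD1 x) //= lerDl sumr_ge0 // => y _; apply: pmf_ge0.
Qed.

Lemma pmf_eq0_notin (R : realType) (T : finType) (p : pmf R T) (B : {set T}) x :
  \sum_(y in B) p y = 1 -> x \notin B -> p x = 0.
Proof.
move=> hB; have := pmf_sum1 p; rewrite (bigID (mem B)) /= hB.
move/(canRL (addKr _)); rewrite addNr => h.
by apply: (psumr_eq0P _ h) => y _; apply: pmf_ge0.
Qed.

(** * Occupancies under the Reset Cliff assumption *)

Section ResetCliffOccupancy.
Context {R : realType} {S A : finType} {n : nat}.
Variables (M : mdp R S A n.+1) (expert : 'I_n.+1 -> S -> A).
Variables (good : {set S}) (a1 : A).
Hypothesis rc : reset_cliff M expert good a1.
Implicit Types (pi : policy R S A n.+1) (h : 'I_n.+1).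

Local Notation expert_pi := (det_policy R expert).

Lemma trans_to_good h s a s' : s' \in good ->
  ~~ ((s \in good) && (a == a1)) -> trans M h s a s' = 0.
Proof.
move=> hs'; have hB : s' \notin ~: good by rewrite inE hs'.
have [hs /= ha|hs _] := boolP (s \in good).
  by apply: pmf_eq0_notin hB; apply: (rc_trans_cliff rc).
by apply: pmf_eq0_notin hB; apply: (rc_trans_bad rc).
Qed.

Lemma sum_good_a1 (F : S * A -> R) :
  (forall s a, ~~ ((s \in good) && (a == a1)) -> F (s, a) = 0) ->
  \sum_x F x = \sum_(s in good) F (s, a1).
Proof.
move=> F0; rewrite (eq_bigr (fun x => F (x.1, x.2))); last by case.
rewrite -(pair_bigA _ (fun s a => F (s, a))) /= [RHS]big_mkcond /=.
apply: eq_bigr => s _; case: ifPn => hs.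
  by rewrite (bigD1 a1) //= big1 ?addr0 // => a ha; rewrite F0 // hs.
by rewrite big1 // => a _; rewrite F0 // negb_and hs.
Qed.

(** Mass enters a good state only from good states through [a1], so the recursion closes on these
    pairs. *)
Lemma occupancy_succ_good pi h h' s' a' : h' = h.+1 :> nat -> s' \in good ->
  occupancy M pi h' s' a'
  = (\sum_(s in good) occupancy M pi h s a1 * trans M h s a1 s') * pi h' s' a'.
Proof.
move=> hh' hs'; rewrite (occupancy_succ _ _ _ _ hh') sum_good_a1 //= => s a hsa.
by rewrite (trans_to_good _ hs' hsa) mulr0.
Qed.

Lemma expert_pi_a1 h s : s \in good -> expert_pi h s a1 = 1.
Proof. by move=> hs; rewrite /= (rc_expert rc) // eqxx. Qed.

(** The recursion on good states is monotone in the previous occupancies, and its policy factor, at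
    most 1, equals 1 for the expert. *)
Lemma occupancy_le_expert pi h s : s \in good ->
  occupancy M pi h s a1 <= occupancy M expert_pi h s a1.
Proof.
elim/ord_step_ind: h s => [s hs|h h' hh' IH s' hs'].
  rewrite !occupancy_ord0 expert_pi_a1 //.
  by rewrite ler_wpM2l ?pmf_ge0 ?pmf_le1.
rewrite !(occupancy_succ_good _ _ hh' hs') expert_pi_a1 // mulr1.
rewrite (le_trans (ler_piMr _ (pmf_le1 _ _))) //.
  by apply: sumr_ge0 => s _; rewrite mulr_ge0 ?occupancy_ge0 ?pmf_ge0.
by apply: ler_sum => s hs; rewrite ler_wpM2r ?pmf_ge0 ?IH.
Qed.

Lemma sum_occupancy_expert h :
  \sum_(s in good) occupancy M expert_pi h s a1 = 1.
Proof.
elim/ord_step_ind: h => [|h h' hh' IH].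
  rewrite -(pmf_sum1 (init M)) [RHS](bigID (mem good)) /=.
  rewrite [X in _ + X]big1 ?addr0; last by move=> s; apply: (rc_init rc).
  by apply: eq_bigr => s hs; rewrite occupancy_ord0 expert_pi_a1 // mulr1.
rewrite -[RHS]IH.
transitivity (\sum_(s' in good) \sum_(s in good)
    occupancy M expert_pi h s a1 * trans M h s a1 s').
  apply: eq_bigr => s' hs'.
  by rewrite (occupancy_succ_good _ _ hh' hs') expert_pi_a1 // mulr1.
rewrite exchange_big; apply: eq_bigr => s hs.
by rewrite -mulr_sumr (rc_trans_good rc) // mulr1.
Qed.

(** The pairs of a good state with [a1] already carry the whole mass 1. *)
Lemma occupancy_expert_eq0 h s a : ~~ ((s \in good) && (a == a1)) ->
  occupancy M expert_pi h s a = 0.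
Proof.
pose G (x : S * A) := (x.1 \in good) && (x.2 == a1).
have := sum_occupancy M expert_pi h; rewrite (bigID G) /=.
rewrite (_ : \sum_(x | G x) _ = 1); last first.
  rewrite big_mkcond -(sum_occupancy_expert h) sum_good_a1.
    by apply: eq_bigr => s' hs'; rewrite /G /= hs' eqxx.
  by move=> s' a' /negbTE h'; rewrite /G /= h'.
move/(canRL (addKr _)); rewrite addNr => h0 hsa.
by apply: (psumr_eq0P _ h0 (i := (s, a))) => // x _; apply: occupancy_ge0.
Qed.

Lemma value_good pi :
  value M pi = \sum_h \sum_(s in good) occupancy M pi h s a1.
Proof.
rewrite valueE; apply: eq_bigr => h _; rewrite sum_good_a1 /=; last first.
  move=> s a; have [hs /= ha|hs _] := boolP (s \in good).
    by rewrite (rc_reward_other rc) ?mulr0.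
  by rewrite (rc_reward_bad rc) ?mulr0.
by apply: eq_bigr => s hs; rewrite (rc_reward_a1 rc) ?mulr1.
Qed.

(* Positivity of the transitions among good states spreads a deficit at [h] to
   every good state at the next step. *)
Lemma occupancy_eq_expert_pred pi h h' s' : h' = h.+1 :> nat -> s' \in good ->
  occupancy M expert_pi h' s' a1 <= occupancy M pi h' s' a1 ->
  {in good, forall s, occupancy M pi h s a1 = occupancy M expert_pi h s a1}.
Proof.
move=> hh' hs'; rewrite !(occupancy_succ_good _ _ hh' hs') expert_pi_a1 // mulr1.
set d := \sum_(s in good) occupancy M pi h s a1 * _ => hle.
have d0 : 0 <= d.
  by apply: sumr_ge0 => s _; rewrite mulr_ge0 ?occupancy_ge0 ?pmf_ge0.
(* Dropping the policy factor leaves a comparison of sums over predecessors, where the terms are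
   ordered the opposite way; all of them must then agree. *)
have {}hle := le_trans hle (ler_piMr d0 (pmf_le1 _ _)).
have F0 s : s \in good -> 0 <= (occupancy M expert_pi h s a1
    - occupancy M pi h s a1) * trans M h s a1 s'.
  by move=> hs; rewrite mulr_ge0 ?pmf_ge0 // subr_ge0 occupancy_le_expert.
have hsum : \sum_(s in good) (occupancy M expert_pi h s a1
    - occupancy M pi h s a1) * trans M h s a1 s' = 0.
  apply: le_anti; rewrite sumr_ge0 // andbT.
  under eq_bigr => s _ do rewrite mulrBl.
  by rewrite sumrB subr_le0.
move=> s hs; have /eqP := psumr_eq0P F0 hsum hs.
rewrite mulf_eq0 (gt_eqF (rc_trans_pos rc h hs hs')) orbF subr_eq0.
by move/eqP.
Qed.

End ResetCliffOccupancy.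

Lemma sum_eq_le (R : realType) (I : finType) (f g : I -> R) :
  (forall i, f i <= g i) -> \sum_i g i <= \sum_i f i -> forall i, f i = g i.
Proof.
move=> fg gf i; apply/eqP; rewrite eq_sym -subr_eq0; apply/eqP.
have h0 : \sum_i (g i - f i) = 0.
  apply: le_anti; rewrite sumr_ge0 => [|j _]; last by rewrite subr_ge0.
  by rewrite sumrB subr_le0 gf.
by apply: (psumr_eq0P _ h0) => // j _; rewrite subr_ge0.
Qed.

(** Termwise [|x| = x + 2 max(0, -x)] with [x = p i - q i], and these differences sum to 0. *)
Lemma sum_norm_sub (R : realType) (I : finType) (p q : I -> R) :
  \sum_i p i = \sum_i q i ->
  \sum_i `|p i - q i| = \sum_i Num.max 0 (q i - p i) *+ 2.
Proof.
move=> pq; apply/eqP; rewrite -subr_eq0 -sumrB.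
rewrite (eq_bigr (fun i => p i - q i)) ?sumrB ?pq ?subrr // => i _.
rewrite mulr2n; case: (ler0P (p i - q i));
  by case: (ler0P (q i - p i)); lra.
Qed.

(** * Second moments of sums of independent centred samples *)

Section ProductMoments.
Context {R : realType} {T : finType} {m : nat}.
Variables (q g : T -> R).
Hypothesis q1 : \sum_t q t = 1.

Lemma sum_prod_weight : \sum_(D : {ffun 'I_m -> T}) \prod_i q (D i) = 1.
Proof.
rewrite -(bigA_distr_bigA (fun (i : 'I_m) t => q t)) /=.
by apply: big1 => i _.
Qed.

Hypothesis g0 : \sum_t q t * g t = 0.

Lemma sum_prod_weight_mul (i j : 'I_m) :
  \sum_(D : {ffun 'I_m -> T}) (\prod_k q (D k)) * (g (D i) * g (D j))
  = (\sum_t q t * g t ^+ 2) *+ (i == j).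
Proof.
(* One factor per coordinate, so that the sum over datasets distributes over the product; for
   [i = j] both conditions fire and yield the square. *)
pose F (k : 'I_m) t := q t *
  ((if k == i then g t else 1) * (if k == j then g t else 1)).
transitivity (\sum_(D : {ffun 'I_m -> T}) \prod_k F k (D k)).
  apply: eq_bigr => D _; rewrite !big_split /= -!big_mkcond /=.
  by rewrite !big_pred1_eq.
rewrite -(bigA_distr_bigA F) (bigD1 i) //= /F eqxx.
have [<-|hij] := eqVneq i j; last first.
  by under eq_bigr => t _ do rewrite mulr1; rewrite g0 mul0r.
rewrite [X in _ * X]big1 ?mulr1 // => k /negbTE hk.
by rewrite hk; under eq_bigr => t _ do rewrite !mulr1.
Qed.

Lemma second_moment_sum :
  \sum_(D : {ffun 'I_m -> T}) (\prod_k q (D k)) * (\sum_i g (D i)) ^+ 2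
  = m%:R * \sum_t q t * g t ^+ 2.
Proof.
under eq_bigr => D _ do rewrite expr2 big_distrlr mulr_sumr.
rewrite exchange_big /=.
transitivity (\sum_(i < m) \sum_t q t * g t ^+ 2); last first.
  by rewrite sumr_const card_ord mulr_natl.
apply: eq_bigr => i _.
under eq_bigr => D _ do rewrite mulr_sumr.
rewrite exchange_big /= (bigD1 i) //= sum_prod_weight_mul eqxx mulr1n.
by rewrite [X in _ + X]big1 ?addr0 // => j hj; rewrite sum_prod_weight_mul eq_sym (negbTE hj).
Qed.

End ProductMoments.

(** * Total mass and variance of the empirical distribution *)

Lemma empiricalE (R : realType) (S A : finType) (H m : nat)
    (D : dataset S A H m) h s a :
  empirical D h s a = (\sum_i (D i h == (s, a))%:R) / m%:R :> R.
Proof.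
rewrite /empirical -sum1_card natr_sum big_mkcond /=; congr (_ / _).
by apply: eq_bigr => i _; rewrite inE; case: eqP.
Qed.

Lemma sum_empirical (R : realType) (S A : finType) (H m : nat)
    (D : dataset S A H m) h : (0 < m)%N ->
  \sum_(x : S * A) empirical D h x.1 x.2 = 1 :> R.
Proof.
move=> hm; under eq_bigr => x _ do rewrite empiricalE -surjective_pairing.
rewrite -mulr_suml exchange_big /=.
under eq_bigr => i _ do under eq_bigr => x _ do rewrite eq_sym.
under eq_bigr => i _ do rewrite dirac_sum1.
by rewrite sumr_const card_ord mulfV // pnatr_eq0 -lt0n.
Qed.

(** Up to the factor [m], the deviation is a sum of [m] independent centred indicators, with
    variance [p - p ^+ 2] each. *)
Lemma empirical_variance (R : realType) (S A : finType) (n m : nat)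
    (M : mdp R S A n.+1) (pi : policy R S A n.+1) h s a : (0 < m)%N ->
  dataset_expectation M pi (fun D : dataset S A n.+1 m =>
    (empirical D h s a - occupancy M pi h s a) ^+ 2)
  <= occupancy M pi h s a / m%:R.
Proof.
move=> hm; set p := occupancy M pi h s a.
have m0 : m%:R != 0 :> R by rewrite pnatr_eq0 -lt0n.
pose g (tau : trajectory S A n.+1) : R := (tau h == (s, a))%:R - p.
have sum_ind : \sum_tau traj_prob M pi tau * (tau h == (s, a))%:R = p.
  rewrite /p /occupancy [RHS]big_mkcond /=; apply: eq_bigr => tau _.
  by case: eqP; rewrite ?mulr1 ?mulr0.
have g0 : \sum_tau traj_prob M pi tau * g tau = 0.
  under eq_bigr => tau _ do rewrite mulrBr.
  by rewrite sumrB sum_ind -mulr_suml sum_traj_prob mul1r subrr.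
have g2 : \sum_tau traj_prob M pi tau * g tau ^+ 2 = p - p ^+ 2.
  (* An indicator [b] equals its square, so [(b - p) ^+ 2] is affine in [b]. *)
  transitivity (\sum_tau (traj_prob M pi tau * (tau h == (s, a))%:R * (1 - 2 * p)
      + traj_prob M pi tau * p ^+ 2)).
    by apply: eq_bigr => tau _; rewrite /g; case: eqP => _ /=; ring.
  by rewrite big_split /= -!mulr_suml sum_ind sum_traj_prob; ring.
have -> : dataset_expectation M pi (fun D : dataset S A n.+1 m =>
    (empirical D h s a - p) ^+ 2) = (p - p ^+ 2) / m%:R.
  rewrite /dataset_expectation /dataset_prob.
  transitivity ((\sum_(D : {ffun 'I_m -> trajectory S A n.+1})
    (\prod_i traj_prob M pi (D i)) * (\sum_i g (D i)) ^+ 2) / m%:R ^+ 2).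
    rewrite mulr_suml; apply: eq_bigr => D _; rewrite -mulrA -expr_div_n.
    congr (_ * _ ^+ 2); rewrite empiricalE /g sumrB sumr_const card_ord.
    by rewrite mulrBl -[p *+ m]mulr_natr mulfK.
  by rewrite second_moment_sum ?sum_traj_prob // g2; field.
by rewrite ler_wpM2r ?invr_ge0 ?ler0n // gerBl sqr_ge0.
Qed.

(** * The value gap of a VAIL solution for a fixed dataset *)

Section VailGap.
Context {R : realType} {S A : finType} {n m : nat}.
Variables (M : mdp R S A n.+1) (expert : 'I_n.+1 -> S -> A).
Variables (good : {set S}) (a1 : A).
Hypothesis rc : reset_cliff M expert good a1.
Hypothesis m_gt0 : (0 < m)%N.
Variable D : dataset S A n.+1 m.
Implicit Types (pi : policy R S A n.+1) (h : 'I_n.+1).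

Local Notation expert_pi := (det_policy R expert).

(** Both measures have mass 1 at each step, so [sum_norm_sub] applies. The single index [z] lets
    [sum_eq_le] compare all terms at once. *)
Lemma vail_lossE pi : vail_loss M D pi
  = \sum_(z : 'I_n.+1 * (S * A)) Num.max 0
      (empirical D z.1 z.2.1 z.2.2 - occupancy M pi z.1 z.2.1 z.2.2) *+ 2.
Proof.
rewrite -(pair_bigA _ (fun h x => Num.max 0
  (empirical D h x.1 x.2 - occupancy M pi h x.1 x.2) *+ 2)) /=.
apply: eq_bigr => h _; rewrite pair_bigA /=.
by rewrite sum_norm_sub // sum_occupancy sum_empirical.
Qed.

Hypothesis D_good : forall i h, (D i h).1 \in good /\ (D i h).2 = a1.

Lemma empirical_eq0 h s a : ~~ ((s \in good) && (a == a1)) ->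
  empirical D h s a = 0 :> R.
Proof.
move=> hsa; rewrite empiricalE big1 ?mul0r // => i _.
case: eqP => // hD; have [] := D_good i h; rewrite hD /= => hs ha.
by rewrite hs ha eqxx in hsa.
Qed.

(* The loss is twice the sum of the positive parts of the empirical excess,
   which the expert minimizes termwise. *)
Lemma vail_solution_excess pi h s : vail_solution M D pi -> s \in good ->
  Num.max 0 (empirical D h s a1 - occupancy M expert_pi h s a1)
  = Num.max 0 (empirical D h s a1 - occupancy M pi h s a1).
Proof.
move=> /(_ expert_pi); rewrite !vail_lossE => hle hs.
suff /(_ (h, (s, a1))) /= : forall z : 'I_n.+1 * (S * A),
    Num.max 0 (empirical D z.1 z.2.1 z.2.2
      - occupancy M expert_pi z.1 z.2.1 z.2.2) *+ 2
    = Num.max 0 (empirical D z.1 z.2.1 z.2.2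
      - occupancy M pi z.1 z.2.1 z.2.2) *+ 2.
  by rewrite !mulr2n; lra.
apply: sum_eq_le hle => -[h' [s' a']] /=; apply: ler_wMn2r.
have [/andP[hs' /eqP ->]|hsa] := boolP ((s' \in good) && (a' == a1)).
  by rewrite ge_max le_max lexx le_max lerD2l lerN2 (occupancy_le_expert rc) ?orbT.
(* Off the good pairs both the empirical and the expert masses vanish, so the expert term is 0. *)
by rewrite (empirical_eq0 _ hsa) (occupancy_expert_eq0 rc) // subrr maxxx le_max lexx.
Qed.

(** Both sides sum to 1 over the good states, so the empirical mass cannot be strictly smaller
    everywhere. *)
Lemma exists_empirical_ge h : exists2 s, s \in good &
  occupancy M expert_pi h s a1 <= empirical D h s a1.
Proof.
have sum_emp : \sum_(s in good) empirical D h s a1 = 1 :> R.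
  rewrite -(sum_empirical R D h m_gt0) (sum_good_a1 (good := good) (a1 := a1)) //.
  exact: empirical_eq0.
apply/exists_inP; apply: contraT; rewrite negb_exists_in => /forall_inP hlt.
have : \sum_(s in good) empirical D h s a1
    < \sum_(s in good) occupancy M expert_pi h s a1 :> R.
  apply: ltr_sum => [|s /hlt]; last by rewrite -ltNge.
  (* Strictness needs a good state; without one the empirical mass would be 0 instead of 1. *)
  apply: contraT => /hasPn hno.
  move: sum_emp; rewrite big1 => [/esym/eqP|s hs]; first by rewrite oner_eq0.
  by have := hno s (mem_index_enum s); rewrite hs.
by rewrite sum_emp (sum_occupancy_expert rc) ltxx.
Qed.

(** At a good state of step [h + 1] where the empirical mass reaches the expert's, equal excesses
    force [pi] to have at least the expert's occupancy; this propagates back to step [h]. *)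
Lemma vail_solution_expert pi h : vail_solution M D pi -> (h < n)%N ->
  {in good, forall s, occupancy M pi h s a1 = occupancy M expert_pi h s a1}.
Proof.
move=> sol hn; have [s' hs' hle] := exists_empirical_ge (inord h.+1).
apply: (occupancy_eq_expert_pred rc (h' := inord h.+1) _ hs'); first by rewrite inordK // ltnS.
have := vail_solution_excess (inord h.+1) sol hs'.
by case: (ler0P (_ - occupancy M expert_pi _ _ _));
  case: (ler0P (_ - occupancy M pi _ _ _)); lra.
Qed.

(** Earlier steps cancel. At the last one, equal excesses leave no gap where the empirical mass is
    at least the expert's; elsewhere [pi] has at least the empirical mass. *)
Lemma vail_gap pi : vail_solution M D pi ->
  value M expert_pi - value M pi
  <= \sum_(s in good)
       `|empirical D ord_max s a1 - occupancy M expert_pi ord_max s a1|.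
Proof.
move=> sol; rewrite !(value_good rc) -sumrB big_ord_recr /= big1 ?add0r.
  rewrite -sumrB; apply: ler_sum => s hs.
  have := vail_solution_excess ord_max sol hs.
  have := occupancy_le_expert rc pi ord_max hs.
  by case: (ler0P (_ - occupancy M expert_pi _ _ _));
    case: (ler0P (_ - occupancy M pi _ _ _)); lra.
move=> i _; rewrite -sumrB big1 // => s hs.
by rewrite vail_solution_expert ?subrr //=.
Qed.

End VailGap.

(** Supplies the hypothesis [D_good]: a trajectory through any other pair has probability bounded by
    a zero expert occupancy. *)
Lemma dataset_prob_neq0_good (R : realType) (S A : finType) (n m : nat)
    (M : mdp R S A n.+1) (expert : 'I_n.+1 -> S -> A)
    (good : {set S}) (a1 : A) (rc : reset_cliff M expert good a1)
    (D : dataset S A n.+1 m) :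
  dataset_prob M (det_policy R expert) D != 0 ->
  forall i h, (D i h).1 \in good /\ (D i h).2 = a1.
Proof.
move=> D0 i h; suff /andP[-> /eqP ->] :
  ((D i h).1 \in good) && ((D i h).2 == a1) by [].
apply: contraT => hD; case/eqP: D0; rewrite /dataset_prob (bigD1 i) //=.
have -> : traj_prob M (det_policy R expert) (D i) = 0; last by rewrite mul0r.
apply: le_anti; rewrite traj_prob_ge0 andbT.
by rewrite -(occupancy_expert_eq0 rc h hD) le_traj_prob_occupancy.
Qed.

(** AM-GM with a free weight [c], which bounds a first moment by a second one without square
    roots. *)
Lemma norm_le_sqr_scaled (R : realFieldType) (c x : R) : 0 < c ->
  `|x| <= c / 2 * x ^+ 2 + (2 * c)^-1.
Proof.
move=> c0; rewrite -subr_ge0.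
have -> : c / 2 * x ^+ 2 + (2 * c)^-1 - `|x| = (c * `|x| - 1) ^+ 2 / (2 * c).
  by rewrite -(real_normK (num_real x)); field; rewrite gt_eqF.
by rewrite divr_ge0 ?sqr_ge0 // mulr_ge0 // ltW.
Qed.

(** * The expected gap over the random dataset *)

Theorem theorem3 (R : realType) :
  exists C : R, 0 < C /\
    forall (S A : finType) (H : nat) (M : mdp R S A H)
      (expert : 'I_H -> S -> A) (good : {set S}) (a1 : A),
      reset_cliff M expert good a1 ->
    forall (eps : R) (m : nat),
      0 < eps -> eps <= H%:R ->
      (1 <= m)%N -> C * #|S|%:R / eps ^+ 2 <= m%:R ->
    forall ail : dataset S A H m -> policy R S A H,
      (forall D : dataset S A H m, vail_solution M D (ail D)) ->
      value M (det_policy R expert)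
        - dataset_expectation M (det_policy R expert)
            (fun D => value M (ail D)) <= eps.
Proof.
exists 1; split=> // S A [|n] M expert good a1 rc eps m eps0 epsH m0 hm ail sol.
  (* Horizon 0 would give [0 < eps <= 0]. *)
  by have := lt_le_trans eps0 epsH; rewrite ltxx.
set E := det_policy R expert.
have P0 D : 0 <= dataset_prob M E D.
  by apply: prodr_ge0 => i _; apply: traj_prob_ge0.
have P1 : \sum_(D : dataset S A n.+1 m) dataset_prob M E D = 1.
  by apply: sum_prod_weight; apply: sum_traj_prob.
have S0 : 0 < #|S|%:R :> R.
  rewrite ltr0n lt0n; apply/negP => /eqP /card0_eq S0.
  have /eqP := pmf_sum1 (init M); rewrite big1 => [|s]; last by have := S0 s.
  by rewrite eq_sym oner_eq0.
have mR0 : 0 < m%:R :> R by rewrite ltr0n.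
(* This weight gives [#|S| / (2 c) = eps / 2] for the constant terms, while the variance term
   [c / (2 m)] is at most [eps / 2] exactly when [#|S| / eps ^+ 2 <= m]. *)
pose c : R := #|S|%:R / eps; have c0 : 0 < c by apply: divr_gt0.
pose dev (D : dataset S A n.+1 m) s :=
  empirical D ord_max s a1 - occupancy M E ord_max s a1.
have gap (D : dataset S A n.+1 m) :
    dataset_prob M E D * (value M E - value M (ail D))
    <= dataset_prob M E D
       * \sum_(s in good) (c / 2 * dev D s ^+ 2 + (2 * c)^-1).
  (* Datasets of probability 0 may leave the good pairs, but they contribute nothing. *)
  have [->|D0] := eqVneq (dataset_prob M E D) 0; first by rewrite !mul0r.
  rewrite ler_wpM2l ?P0 //.
  apply: le_trans (vail_gap rc m0 (dataset_prob_neq0_good rc D0) (sol D)) _.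
  by apply: ler_sum => s _; apply: norm_le_sqr_scaled.
have -> : value M E - dataset_expectation M E (fun D => value M (ail D))
    = \sum_(D : dataset S A n.+1 m)
        dataset_prob M E D * (value M E - value M (ail D)).
  under [RHS]eq_bigr => D _ do rewrite mulrBr.
  by rewrite sumrB -mulr_suml P1 mul1r.
apply: le_trans; first by apply: ler_sum => D _; apply: gap.
have -> : \sum_(D : dataset S A n.+1 m) dataset_prob M E D
       * \sum_(s in good) (c / 2 * dev D s ^+ 2 + (2 * c)^-1)
  = \sum_(s in good) (c / 2 * dataset_expectation M E
      (fun D : dataset S A n.+1 m => dev D s ^+ 2) + (2 * c)^-1).
  under eq_bigr => D _ do rewrite mulr_sumr.
  rewrite exchange_big /=; apply: eq_bigr => s _.
  under eq_bigr => D _ do rewrite mulrDr mulrCA.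
  by rewrite big_split /= -mulr_sumr -mulr_suml P1 mul1r.
have bound s : c / 2 * dataset_expectation M E
      (fun D : dataset S A n.+1 m => dev D s ^+ 2) + (2 * c)^-1
    <= c / 2 * (occupancy M E ord_max s a1 / m%:R) + (2 * c)^-1.
  rewrite lerD2r ler_wpM2l ?empirical_variance //.
  by rewrite divr_ge0 // ltW.
apply: le_trans; first by apply: ler_sum => s _; apply: bound.
(* The expert occupancies sum to 1 over the good states, so the variances add up to at most
   [1 / m]. *)
rewrite big_split /= -mulr_sumr -mulr_suml (sum_occupancy_expert rc).
rewrite sumr_const -[_ *+ #|_|]mulr_natr.
have hgood : (2 * c)^-1 * #|good|%:R <= eps / 2.
  have -> : eps / 2 = (2 * c)^-1 * #|S|%:R.
    by rewrite /c; field; rewrite !gt_eqF.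
  by rewrite ler_wpM2l ?ler_nat ?max_card // invr_ge0 mulr_ge0 // ltW.
have hvar : c / 2 * (1 / m%:R) <= eps / 2.
  move: hm; rewrite mul1r ler_pdivrMr ?exprn_gt0 // => hm.
  have -> : c / 2 * (1 / m%:R) = #|S|%:R / (2 * eps * m%:R).
    by rewrite /c; field; rewrite !gt_eqF.
  rewrite ler_pdivrMr ?mulr_gt0 //; apply: le_trans hm _.
  by rewrite le_eqVlt; apply/orP; left; apply/eqP; field.
by rewrite [leRHS]splitr lerD.
Qed.
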